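(* There exists a universal constant $c>0$ such that for every integer $n\ge1$ and every increasing and balanced family $\mathcal{A}\subseteq\Omega_n=\{0,1\}^n$ there exists a Boolean function $h\in\{\mathbf{x}_1,\dots,\mathbf{x}_n,\mathrm{Maj}\}$ such that $$\mathrm{Cov}_\mu(\mathbf{1}_{\mathcal{A}},h)\ \ge\ c\,\frac{\log n}{\sqrt n}.$$
   Context: $\Omega_n=\{0,1\}^n$ and $\mu$ is the uniform probability measure on $\Omega_n$. For $u,v:\Omega_n\to\mathbb{R}$, $\mathrm{Cov}_\mu(u,v)=\mathbb{E}_\mu[uv]-\mathbb{E}_\mu[u]\,\mathbb{E}_\mu[v]$. A family $\mathcal{A}\subseteq\Omega_n$ is increasing if $x\in\mathcal{A}$ and $x\le y$ coordinatewise imply $y\in\mathcal{A}$. It is balanced if $\mu(\mathcal{A})=1/2$. $\mathbf{x}_i:\Omega_n\to\{0,1\}$ is the $i$-th coordinate projection $\mathbf{x}_i(x)=x_i$, and $\mathrm{Maj}(x)=\mathbf{1}_{\{\sum_{i=1}^n x_i>n/2\}}$. $\log$ is the natural logarithm. *)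

(* Defs.v *)
(* MathComp world, with real numbers from MathComp-Analysis. *)
From HB Require Import structures.
From mathcomp Require Export all_boot all_order all_algebra.
From mathcomp Require Export reals exp.

Set Implicit Arguments.
Unset Strict Implicit.
Unset Printing Implicit Defensive.

Import Order.TTheory GRing.Theory Num.Theory.

Local Open Scope ring_scope.

Definition Omega (n : nat) : finType := {ffun 'I_n -> bool}.

Definition mu (R : realType) (n : nat) (A : {set Omega n}) : R :=
  #|A|%:R / #|Omega n|%:R.

Definition expect (R : realType) (n : nat) (u : Omega n -> R) : R :=
  \sum_(x : Omega n) u x * mu R [set x].

Definition cov (R : realType) (n : nat) (u v : Omega n -> R) : R :=
  expect (fun x => u x * v x) - expect u * expect v.

Definition ind1 (R : realType) (n : nat) (A : {set Omega n}) (x : Omega n) : R :=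
  (x \in A)%:R.

Definition cube_le (n : nat) (x y : Omega n) : Prop := forall i, x i ==> y i.

Definition increasing (n : nat) (A : {set Omega n}) : Prop :=
  forall x y : Omega n, x \in A -> cube_le x y -> y \in A.

Definition balanced (R : realType) (n : nat) (A : {set Omega n}) : Prop :=
  mu R A = 1 / 2.

(* Boolean functions are finite functions, so that they form finite sets. *)
Definition boolfun (n : nat) : finType := {ffun Omega n -> bool}.

Definition xproj (n : nat) (i : 'I_n) : boolfun n := [ffun x : Omega n => x i].

(* The condition \sum_i x_i > n / 2 with the denominator cleared; the inequality
   is strict, so for even n a tie gives the value 0. *)
Definition Maj (n : nat) : boolfun n :=
  [ffun x : Omega n => (n < 2 * \sum_(i < n) x i)%N].

(* Main.v *)
Require Import Defs.
From mathcomp Require Import all_boot all_order all_algebra.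
From mathcomp Require Import reals exp ring lra zify.

(**
  The argument is KKL, localized to the bulk of the cube. Let [f = 1_A],
  [s = sqrt n] and let [chi] be a cutoff in [|x|], equal to [0] as soon as
  [||x| - n/2| >= 4 s] and [1/(4 s)]-Lipschitz along the edges. The function
  [F = (2 f - 1) chi] has small mean and variance of order one; its discrete
  derivatives are those of [f] in the bulk, up to terms whose total energy is a
  small constant. If all influences of [f] are at most [c log n / sqrt n],
  hypercontractivity makes the Fourier weight of [F] of degree at most [d ~ log n]
  small, so the weight above [d], which is at most [1/d] times the energy, is of
  order one: the number of pivotal edges of [f] in the bulk is at least [c d 2^n].

  On the other hand summation by parts writes [cov f Maj] as a sum of [w(|x|)]
  over the pivotal edges [x, x + e_i], where [w >= 0] solves a first-order
  recursion; comparison with affine subsolutions gives [w >= 1/(33 s)] in the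
  bulk. Hence [cov f Maj] is at least a constant times [d / s].
*)

Set Implicit Arguments.
Unset Strict Implicit.
Unset Printing Implicit Defensive.

Import Order.TTheory GRing.Theory Num.Theory.

Local Open Scope ring_scope.

(** * Expectation over the uniform cube, Cauchy-Schwarz, coordinate flips *)

Section Expectation.
Variables (R : realType) (n : nat).
Implicit Types (u v : Omega n -> R) (x y : Omega n).

Lemma expectE u : expect u = (2 ^+ n)^-1 * \sum_x u x.
Proof.
rewrite /expect mulr_sumr; apply: eq_bigr => x _.
by rewrite /mu cards1 card_ffun card_bool card_ord natrX mulrC mul1r.
Qed.

Lemma eq_expect u v : u =1 v -> expect u = expect v.
Proof. by move=> uv; apply: eq_bigr => x _; rewrite uv. Qed.

Lemma expectD u v : expect (fun x => u x + v x) = expect u + expect v.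
Proof. by rewrite !expectE -mulrDr big_split. Qed.

Lemma expectZ (a : R) u : expect (fun x => a * u x) = a * expect u.
Proof. by rewrite !expectE mulrCA -mulr_sumr. Qed.

Lemma expectN u : expect (fun x => - u x) = - expect u.
Proof. by rewrite !expectE sumrN mulrN. Qed.

Lemma expectB u v : expect (fun x => u x - v x) = expect u - expect v.
Proof. by rewrite expectD expectN. Qed.

Lemma expect_sum (I : finType) (P : pred I) (F : I -> Omega n -> R) :
  expect (fun x => \sum_(i | P i) F i x) = \sum_(i | P i) expect (F i).
Proof.
rewrite expectE exchange_big mulr_sumr; apply: eq_bigr => i _.
by rewrite expectE.
Qed.

Lemma expect_cst (a : R) : expect (fun _ : Omega n => a) = a.
Proof.
rewrite expectE sumr_const card_ffun card_bool card_ord -[a *+ _]mulr_natr natrX mulrCA.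
by rewrite mulVf ?mulr1 // expf_neq0 // pnatr_eq0.
Qed.

Lemma ler_expect u v : (forall x, u x <= v x) -> expect u <= expect v.
Proof.
move=> uv; rewrite !expectE ler_wpM2l ?invr_ge0 ?exprn_ge0 //.
exact: ler_sum.
Qed.

Lemma expect_ge0 u : (forall x, 0 <= u x) -> 0 <= expect u.
Proof. by move=> u0; rewrite -(expect_cst 0); apply: ler_expect. Qed.

Lemma expect_inv (g : Omega n -> Omega n) u :
  involutive g -> expect (fun x => u (g x)) = expect u.
Proof.
by move=> gK; rewrite !expectE [in RHS](reindex_inj (inv_inj gK)).
Qed.

(** Lagrange's identity: the mean of [(u x * v y - u y * v x) ^+ 2] over independent [x], [y] is
    twice the gap between the two sides. *)
Lemma expect_CS u v :
  expect (fun x => u x * v x) ^+ 2 <=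
  expect (fun x => u x ^+ 2) * expect (fun x => v x ^+ 2).
Proof.
pose a := expect (fun x => u x ^+ 2).
pose b := expect (fun x => v x ^+ 2).
pose c := expect (fun x => u x * v x).
have : 0 <= expect (fun x => expect (fun y => (u x * v y - u y * v x) ^+ 2)).
  by do 2!apply: expect_ge0 => ?; rewrite sqr_ge0.
have -> : expect (fun x => expect (fun y => (u x * v y - u y * v x) ^+ 2)) =
          expect (fun x => (b * (u x ^+ 2) + a * (v x ^+ 2)) - c * (2 * (u x * v x))).
  apply: eq_expect => x.
  have -> : b * (u x ^+ 2) + a * (v x ^+ 2) - c * (2 * (u x * v x)) =
     u x ^+ 2 * b + v x ^+ 2 * a - (2 * (u x * v x)) * c by ring.
  rewrite -!expectZ -expectD -expectB.
  by apply: eq_expect => y /=; ring.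
rewrite expectB expectD !expectZ -/a -/b -/c; nra.
Qed.

Definition flip (i : 'I_n) x : Omega n := [ffun j => x j (+) (j == i)].

Lemma flipK i : involutive (flip i).
Proof. by move=> x; apply/ffunP => j; rewrite !ffunE addbK. Qed.

Lemma flipE i x j : flip i x j = x j (+) (j == i).
Proof. by rewrite ffunE. Qed.

Lemma flip_id i x : flip i x i = ~~ x i.
Proof. by rewrite ffunE eqxx addbT. Qed.

Lemma expect_flip i u : expect (fun x => u (flip i x)) = expect u.
Proof. exact/expect_inv/flipK. Qed.

Lemma expect_flip_odd i u : (forall x, u (flip i x) = - u x) -> expect u = 0.
Proof.
move=> uN; have := expect_flip i u.
rewrite (eq_expect (v := fun x => - u x)) // expectN => /eqP.
by rewrite eq_sym -subr_eq0 opprK -mulr2n mulrn_eq0 => /eqP.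
Qed.

End Expectation.

(** * Walsh-Fourier analysis *)

Section Fourier.
Variables (R : realType) (n : nat).
Implicit Types (F g u v : Omega n -> R) (x y : Omega n) (S D : {set 'I_n}).

(** The Walsh character of [S]. *)
Definition ch S x : R := \prod_(i in S) (-1) ^+ x i.

Definition four F S : R := expect (fun x => F x * ch S x).

Lemma ch_setU1 i S x : i \notin S -> ch (i |: S) x = (-1) ^+ x i * ch S x.
Proof. by move=> iS; rewrite /ch big_setU1. Qed.

Lemma ch_flip i S x : ch S (flip i x) = (-1) ^+ (i \in S) * ch S x.
Proof.
have chN (T : {set _}) : i \notin T -> ch T (flip i x) = ch T x.
  move=> iT; apply: eq_bigr => j jT; rewrite flipE.
  by case: eqP jT iT => [-> ->|]; rewrite ?addbF.
have [iS|iS] := boolP (i \in S); last by rewrite chN // mul1r.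
rewrite -(setD1K iS) !ch_setU1 ?setD11 // chN ?setD11 // flip_id signrN.
by rewrite expr1 mulN1r mulNr.
Qed.

(** The sum expands the product of the factors [1 + (-1)^(x_i + y_i)]; a coordinate where [x] and
    [y] differ makes one factor vanish. *)
Lemma sum_ch x y : \sum_S ch S x * ch S y = 2 ^+ n * (x == y)%:R.
Proof.
transitivity (\prod_(i < n) (((-1) ^+ x i * (-1) ^+ y i : R) + 1)).
  rewrite bigA_distr; apply: eq_bigr => S _.
  rewrite /ch -big_split /= [LHS]big_mkcond; apply: eq_bigr => i _.
  by [].
have [->|neq] := eqVneq x y.
  rewrite mulr1 (eq_bigr (fun=> 2)); first by rewrite prodr_const card_ord.
  by move=> i _; rewrite -expr2 sqrr_sign.
have [i ni] : exists i, x i != y i.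
  apply/existsP; rewrite -negb_forall; apply: contraNN neq => /forallP e.
  by apply/eqP/ffunP => i; apply/eqP.
rewrite mulr0 (bigD1 i) //= (_ : _ + 1 = 0) ?mul0r //.
by rewrite -signr_addb; case: (x i) (y i) ni => [] [] //= _; rewrite expr1 addNr.
Qed.

(** Once both coefficients are written as means over points and the sum over [S] is taken first,
    [sum_ch] leaves only the diagonal. *)
Lemma parseval F : \sum_S four F S ^+ 2 = expect (fun x => F x ^+ 2).
Proof.
under eq_bigr => S _.
  rewrite expr2 {1}/four mulrC -expectZ.
  under eq_expect => x do rewrite /four mulrC -expectZ.
  over.
rewrite -expect_sum; apply: eq_expect => x.
rewrite -expect_sum expectE.
under eq_bigr => y _.
  rewrite (eq_bigr (fun S => (F x * F y) * (ch S x * ch S y))); last first.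
    by move=> S _; ring.
  rewrite -mulr_sumr sum_ch; over.
rewrite (bigD1 x) //= big1 => [|y /negPf]; last first.
  by rewrite eq_sym => ->; rewrite !mulr0.
rewrite eqxx addr0 mulr1 mulrCA mulVf ?mulr1 ?expr2 //.
by rewrite expf_neq0 ?pnatr_eq0.
Qed.

Lemma fourD F g S : four (fun x => F x + g x) S = four F S + four g S.
Proof. by rewrite -expectD; apply: eq_expect => x; rewrite mulrDl. Qed.

(** Halving makes this operator the projection onto the characters whose set contains [i]. *)
Definition ddiff i F x : R := (F x - F (flip i x)) / 2.

Lemma four_ddiff i F S : four (ddiff i F) S = if i \in S then four F S else 0.
Proof.
have E : expect (fun x => F (flip i x) * ch S x) = (-1) ^+ (i \in S) * four F S.
  rewrite -expectZ -(expect_flip i); apply: eq_expect => x.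
  by rewrite flipK ch_flip mulrCA.
rewrite /four /ddiff.
rewrite (eq_expect (v := fun x => 2^-1 * (F x * ch S x - F (flip i x) * ch S x))).
  rewrite expectZ expectB E /four; case: (i \in S); last by rewrite expr0; ring.
  by rewrite expr1 mulN1r opprK mulrC mulrDl -splitr.
by move=> x; rewrite -mulrBl mulrA [2^-1 * _]mulrC.
Qed.

End Fourier.

(** * Hypercontractivity and low-degree Fourier weight *)

Section Hypercontractivity.
Variables (R : realType) (n : nat).
Implicit Types (a : {set 'I_n} -> R) (x : Omega n) (S D : {set 'I_n}).

Lemma sum_subset_setD1 (D : {set 'I_n}) (i : 'I_n) (G : {set 'I_n} -> R) :
  i \in D ->
  \sum_(S : {set 'I_n} | S \subset D) G S =
    \sum_(S : {set 'I_n} | S \subset D :\ i) G S +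
    \sum_(S : {set 'I_n} | S \subset D :\ i) G (i |: S).
Proof.
move=> iD; rewrite (bigID (fun S : {set 'I_n} => i \notin S)) /=; congr (_ + _).
  by apply: eq_bigl => S; rewrite subsetD1.
rewrite (reindex_onto (fun S => i |: S) (fun S => S :\ i)) /=; last first.
  by move=> S /andP[_ /negPn iS]; rewrite setD1K.
apply: eq_bigl => S; rewrite subUset sub1set iD setU11 /= subsetD1 andbT.
congr (_ && _); apply/eqP/idP => [<-|iS]; first by rewrite setD11.
by rewrite setU1K.
Qed.

Lemma ch_sub_flip a D i x : i \notin D ->
  \sum_(S : {set 'I_n} | S \subset D) a S * ch R S (flip i x) =
  \sum_(S : {set 'I_n} | S \subset D) a S * ch R S x.
Proof.
move=> iD; apply: eq_bigr => S SD; rewrite ch_flip.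
by rewrite (negPf (contraNN (subsetP SD i) iD)) mul1r.
Qed.

(* Pulling out one coordinate, P = Q + c R with c a sign independent of Q and R,
   gives E P^4 = E Q^4 + 6 E Q^2 R^2 + E R^4. *)
Lemma bonami D a :
  expect (fun x => (\sum_(S : {set 'I_n} | S \subset D) a S * ch R S x) ^+ 4) <=
  (\sum_(S : {set 'I_n} | S \subset D) 3 ^+ #|S| * a S ^+ 2) ^+ 2.
Proof.
have [m] := ubnP #|D|; elim: m => // m IH in D a *; rewrite ltnS => Dm.
have [->|[i iD]] := set_0Vmem D.
  have e0 G : \sum_(S : {set 'I_n} | S \subset set0) G S = G set0 :> R.
    by rewrite (eq_bigl (pred1 set0)) ?big_pred1_eq // => S; rewrite subset0.
  rewrite e0 cards0 expr0 mul1r -exprM -[leRHS](@expect_cst R n).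
  by apply: ler_expect => x; rewrite e0 /ch big_set0 mulr1.
have iD' : i \notin D :\ i by rewrite setD11.
have D'm : (#|D :\ i| < m)%N by move: Dm; rewrite (cardsD1 i) iD.
pose b S := a (i |: S).
pose Q x := \sum_(S : {set 'I_n} | S \subset D :\ i) a S * ch R S x.
pose T x := \sum_(S : {set 'I_n} | S \subset D :\ i) b S * ch R S x.
pose A := \sum_(S : {set 'I_n} | S \subset D :\ i) 3 ^+ #|S| * a S ^+ 2.
pose B := \sum_(S : {set 'I_n} | S \subset D :\ i) 3 ^+ #|S| * b S ^+ 2.
have QA : expect (fun x => Q x ^+ 4) <= A ^+ 2 := IH _ a D'm.
have TB : expect (fun x => T x ^+ 4) <= B ^+ 2 := IH _ b D'm.
have -> : \sum_(S : {set 'I_n} | S \subset D) 3 ^+ #|S| * a S ^+ 2 = A + 3 * B.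
  rewrite (sum_subset_setD1 _ iD); congr (_ + _).
  rewrite mulr_sumr; apply: eq_bigr => S; rewrite subsetD1 => /andP[_ iS].
  by rewrite cardsU1 iS add1n exprS -mulrA.
have PE x : \sum_(S : {set 'I_n} | S \subset D) a S * ch R S x =
            Q x + (-1) ^+ x i * T x.
  rewrite (sum_subset_setD1 _ iD); congr (_ + _).
  rewrite mulr_sumr; apply: eq_bigr => S; rewrite subsetD1 => /andP[_ iS].
  by rewrite ch_setU1 // mulrCA.
pose odd x := (-1) ^+ x i * (4 * Q x ^+ 3 * T x + 4 * Q x * T x ^+ 3).
rewrite (eq_expect (v := fun x => (Q x ^+ 4 + 6 * (Q x ^+ 2 * T x ^+ 2) + T x ^+ 4)
   + odd x)); last first.
  by move=> x; rewrite PE /odd; case: (x i); rewrite ?expr1 ?expr0; ring.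
rewrite expectD (@expect_flip_odd _ _ i odd) => [|x]; last first.
  rewrite /odd /Q /T !ch_sub_flip // flip_id.
  by case: (x i); rewrite ?expr1 ?expr0; ring.
rewrite !expectD expectZ addr0.
set X := expect (fun x => Q x ^+ 2 * T x ^+ 2).
have X0 : 0 <= X by apply: expect_ge0 => x; rewrite mulr_ge0 ?sqr_ge0.
have A0 : 0 <= A.
  by apply: sumr_ge0 => S _; apply: mulr_ge0; rewrite ?sqr_ge0 ?exprn_ge0 ?ler0n.
have B0 : 0 <= B.
  by apply: sumr_ge0 => S _; apply: mulr_ge0; rewrite ?sqr_ge0 ?exprn_ge0 ?ler0n.
(* Cauchy-Schwarz and the two induction bounds; the lemma then reduces to
   [A^2 + 6 A B + B^2 <= (A + 3 B)^2]. *)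
have XAB : X <= A * B.
  rewrite -(ler_pXn2r (n := 2)) ?nnegrE ?mulr_ge0 //.
  apply: le_trans (expect_CS _ _) _; rewrite exprMn.
  rewrite (eq_expect (v := fun x => Q x ^+ 4)) => [|x]; last by rewrite -exprM.
  rewrite (eq_expect (u := fun x => (T x ^+ 2) ^+ 2) (v := fun x => T x ^+ 4)) => [|x];
    last by rewrite -exprM.
  apply: ler_pM => //; apply: expect_ge0 => x; exact: exprn_even_ge0.
nra.
Qed.

(** The weight [W] is the mean of [g * h], with [h] the low-degree part of [g], and [h] may be
    multiplied by the indicator [b]. Cauchy-Schwarz twice, the second time against the fourth moment
    of [h], gives [W^4 <= 9^d del^3 W^2]. *)
Lemma low_degree_weight (d : nat) (g : Omega n -> R) (b : pred (Omega n)) :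
  (forall x, `|g x| <= (b x)%:R) ->
  (\sum_(S : {set 'I_n} | (#|S| <= d)%N) four g S ^+ 2) ^+ 2 <=
    9 ^+ d * expect (fun x => (b x)%:R) ^+ 3.
Proof.
move=> gb; set W := \sum_(S | _) _; set del := expect _.
pose h x := \sum_(S : {set 'I_n} | (#|S| <= d)%N) four g S * ch R S x.
have W0 : 0 <= W by apply: sumr_ge0 => S _; rewrite sqr_ge0.
have del0 : 0 <= del by apply: expect_ge0 => x; rewrite ler0n.
have WE : W = expect (fun x => g x * ((b x)%:R * h x)).
  rewrite (eq_expect (v := fun x => \sum_(S : {set 'I_n} | (#|S| <= d)%N)
     four g S * (g x * ch R S x))) => [|x].
    by rewrite expect_sum; apply: eq_bigr => S _; rewrite expectZ expr2.
  rewrite (_ : g x * _ = g x * h x).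
    by rewrite mulr_sumr; apply: eq_bigr => S _; rewrite mulrCA.
  case: (b x) (gb x) => [_|]; first by rewrite mul1r.
  by rewrite normr_le0 => /eqP ->; rewrite !mul0r.
have h4 : expect (fun x => h x ^+ 4) <= 9 ^+ d * W ^+ 2.
  (* [bonami] sums over all subsets of a set, so the degree bound is encoded by truncating the
     coefficients. *)
  pose a S := if (#|S| <= d)%N then four g S else 0.
  rewrite (eq_expect (v := fun x =>
    (\sum_(S : {set 'I_n} | S \subset [set: 'I_n]) a S * ch R S x) ^+ 4)) => [|x].
    apply: le_trans (bonami _ _) _.
    rewrite (_ : 9 ^+ d * W ^+ 2 = (3 ^+ d * W) ^+ 2); last first.
      have -> : 9 = 3 ^+ 2 :> R by ring.
      by rewrite exprAC exprMn.
    have s0 (P : pred {set 'I_n}) : 0 <= \sum_(S | P S) 3 ^+ #|S| * a S ^+ 2.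
      by apply: sumr_ge0 => S _; apply: mulr_ge0; rewrite ?sqr_ge0 ?exprn_ge0 ?ler0n.
    rewrite ler_pXn2r ?nnegrE ?mulr_ge0 ?exprn_ge0 ?s0 //.
    rewrite /W mulr_sumr [leRHS]big_mkcond [leLHS]big_mkcond.
    apply: ler_sum => S _; rewrite subsetT /a; case: ifP => Sd; last first.
      by rewrite expr0n mulr0.
    by rewrite ler_wpM2r ?sqr_ge0 // ler_weXn2l // ler1n.
  congr (_ ^+ 4); rewrite /h [LHS]big_mkcond [RHS]big_mkcond.
  by apply: eq_bigr => S _; rewrite subsetT /a; case: ifP; rewrite ?mul0r.
set Y := expect (fun x => ((b x)%:R * h x) ^+ 2).
have Y0 : 0 <= Y by apply: expect_ge0 => x; rewrite sqr_ge0.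
have W2 : W ^+ 2 <= del * Y.
  rewrite {1}WE; apply: le_trans (expect_CS _ _) _.
  rewrite ler_wpM2r //; apply: ler_expect => x.
  rewrite -real_normK ?num_real //.
  by case: (b x) (gb x); rewrite ?expr_le1 // normr_le0 => /eqP ->; rewrite normr0 expr0n.
have Y2 : Y ^+ 2 <= del * (9 ^+ d * W ^+ 2).
  rewrite (_ : Y = expect (fun x => (b x)%:R * h x ^+ 2)); last first.
    by apply: eq_expect => x; rewrite exprMn; case: (b x); rewrite ?expr1n ?expr0n.
  apply: le_trans (expect_CS _ _) _; apply: ler_pM.
  - by apply: expect_ge0 => x; rewrite sqr_ge0.
  - by apply: expect_ge0 => x; rewrite sqr_ge0.
  - by apply: ler_expect => x; case: (b x); rewrite ?expr1n ?expr0n.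
  - rewrite (eq_expect (v := fun x => h x ^+ 4)) // => x.
    by rewrite -exprM.
have [->|Wn0] := eqVneq W 0.
  by rewrite expr0n /= mulr_ge0 ?exprn_ge0.
have Wp : 0 < W ^+ 2 by rewrite exprn_gt0 // lt_def Wn0.
rewrite -(ler_pM2l Wp).
have : W ^+ 2 * W ^+ 2 <= (del * Y) * (del * Y).
  by apply: ler_pM; rewrite ?sqr_ge0.
move/le_trans; apply.
have -> : del * Y * (del * Y) = del ^+ 2 * Y ^+ 2 by ring.
have -> : W ^+ 2 * (9 ^+ d * del ^+ 3) = del ^+ 2 * (del * (9 ^+ d * W ^+ 2)) by ring.
by rewrite ler_wpM2l ?sqr_ge0.
Qed.

End Hypercontractivity.

(** * Lower bounds for the solution of the edge-weight recursion *)

Section Barrier.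
Variable R : realFieldType.

(* [w] is determined by its recursion; the affine functions
   [q (K - k) / (33 n)], [K = n / 2 + 8 s], and its mirror image are subsolutions
   of that recursion, hence lie below [w]. *)
Lemma edge_weight_bounds (n : nat) (w : nat -> R) (r s : R) :
  (0 < n)%N -> s ^+ 2 = n%:R -> 4^-1 <= r <= 3 / 4 ->
  (forall k, (k <= n)%N ->
     k%:R * w k.-1 - (n - k)%:R * w k = (n < 2 * k)%:R - r) ->
  forall k, (k < n)%N ->
    0 <= w k /\
    (n%:R / 2 - 4 * s - 1 <= k%:R <= n%:R / 2 + 4 * s -> s / (33 * n%:R) <= w k).
Proof.
move=> n0 sn /andP[r1 r2] rec.
have nR : 0 < n%:R :> R by rewrite ltr0n.
(* At distance [y] from [n / 2] the affine functions of slope [al] need a source of at most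
   [al * (2 y (8 s - y) + n)], hence at most [33 * al * n], the worst case being [y = 4 s]. This
   [al] turns that into [1/4], a lower bound for both [r] and [1 - r]. *)
pose al : R := (132 * n%:R)^-1.
have al0 : 0 < al by rewrite invr_gt0 mulr_gt0 // ltr0n.
have aln : al * (33 * n%:R) = 4^-1.
  by rewrite /al; field; rewrite pnatr_eq0 -lt0n.
pose K1 : R := n%:R / 2 + 8 * s.
pose K0 : R := n%:R / 2 - 8 * s.
(* Where the majority is 0, solving upwards from [k = 0] has nonnegative coefficients and source
   [r], so both bounds propagate. *)
have low k : (2 * k <= n)%N -> (k < n)%N -> 0 <= w k /\ al * (k%:R + 1 - K0) <= w k.
  elim: k => [|k IH] k2 kn.
    have := rec 0%N (leq0n _); rewrite subn0 mul0r sub0r muln0 ltn0 /= sub0r => /oppr_inj e.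
    split; first by rewrite -(pmulr_rge0 _ nR) e; lra.
    rewrite -(ler_pM2l nR) e; apply: le_trans r1.
    rewrite -aln /K0 mulrCA ler_pM2l // mulrC ler_pM2r // -sn.
    by have := sqr_ge0 (s - 8); lra.
  have [] := IH _ _; try lia.
  move=> w0 wl; have := rec k.+1 (ltnW kn); rewrite ltnNge k2 /= => e.
  have nk : 0 < (n - k.+1)%:R :> R by rewrite ltr0n subn_gt0.
  have k0 : 0 <= k.+1%:R :> R by rewrite ler0n.
  have e' : (n - k.+1)%:R * w k.+1 = k.+1%:R * w k + r by lra.
  split; first by rewrite -(pmulr_rge0 _ nk) e' addr_ge0 ?mulr_ge0 //; lra.
  rewrite -(ler_pM2l nk) e'.
  have : k.+1%:R * (al * (k%:R + 1 - K0)) <= k.+1%:R * w k by rewrite ler_wpM2l.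
  have : (n - k.+1)%:R * (al * (k.+1%:R + 1 - K0)) - k.+1%:R * (al * (k%:R + 1 - K0)) <= 4^-1.
    rewrite -aln natrB ?(ltnW kn) // -[k.+1]addn1 natrD.
    set x := k%:R; rewrite /K0.
    rewrite (_ : _ - _ = al * ((n%:R - 2 * (x + 1)) * (x + 1 - n%:R / 2 + 8 * s) + n%:R - (x + 1))); last by field.
    rewrite ler_pM2l // -sn.
    have x0 : 0 <= x by rewrite ler0n.
    have := sqr_ge0 (x + 1 - s ^+ 2 / 2 + 4 * s); nra.
  lra.
(* Where the majority is 1, the same holds downwards from [k = n], with source [1 - r]; [m] counts
   the steps from the top. *)
have high m : (m < n)%N -> (n < 2 * (n - m))%N ->
   0 <= w (n - m).-1 /\ al * (K1 - ((n - m).-1)%:R) <= w (n - m).-1.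
  elim: m => [|m IH] mn m2.
    have := rec n (leqnn n); rewrite subn0 in m2 *; rewrite subnn mul0r subr0 m2 => e.
    split; first by rewrite -(pmulr_rge0 _ nR) e /=; lra.
    rewrite -(ler_pM2l nR) e /=.
    suff : n%:R * (al * (K1 - n.-1%:R)) <= 4^-1 by lra.
    rewrite -aln /K1 mulrCA ler_pM2l // mulrC ler_pM2r // -subn1 natrB // -sn.
    by have := sqr_ge0 (s - 8); lra.
  have [] := IH _ _; try lia.
  have -> : (n - m).-1 = (n - m.+1)%N by lia.
  have [k kE] : exists k, k = (n - m.+1)%N by exists (n - m.+1)%N.
  have kn : (k < n)%N by lia.
  rewrite -kE in m2 *.
  move=> w0 wl; have := rec k (ltnW kn); rewrite m2 /= => e.
  have k1 : (0 < k)%N by lia.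
  have k0 : 0 < k%:R :> R by rewrite ltr0n.
  have nk : 0 <= (n - k)%:R :> R by rewrite ler0n.
  have e' : k%:R * w k.-1 = (n - k)%:R * w k + (1 - r) by lra.
  split; first by rewrite -(pmulr_rge0 _ k0) e' addr_ge0 ?mulr_ge0 //; lra.
  rewrite -(ler_pM2l k0) e'.
  have : (n - k)%:R * (al * (K1 - k%:R)) <= (n - k)%:R * w k by rewrite ler_wpM2l.
  have : k%:R * (al * (K1 - k.-1%:R)) - (n - k)%:R * (al * (K1 - k%:R)) <= 4^-1.
    rewrite -aln natrB ?(ltnW kn) // -subn1 natrB //.
    have : k%:R <= n%:R :> R by rewrite ler_nat ltnW.
    set x := k%:R; rewrite /K1 => xn.
    rewrite (_ : _ - _ = al * ((2 * x - n%:R) * (n%:R / 2 + 8 * s - x) + x)); last by field.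
    rewrite ler_pM2l //; move: xn; rewrite -sn => xn.
    have := sqr_ge0 (x - s ^+ 2 / 2 - 4 * s); nra.
  lra.
move=> k kn; have [k2|k2] := leqP (2 * k)%N n.
  have [w0 wl] := low k k2 kn; split=> // /andP[h _]; apply: le_trans wl.
  rewrite (_ : s / _ = al * (4 * s)); last by rewrite /al; field; rewrite pnatr_eq0 -lt0n.
  by rewrite ler_pM2l // /K0; lra.
have [] := high (n - k.+1)%N _ _; try lia.
have -> : (n - (n - k.+1)).-1 = k by lia.
move=> w0 wl; split=> // /andP[_ h]; apply: le_trans wl.
rewrite (_ : s / _ = al * (4 * s)); last by rewrite /al; field; rewrite pnatr_eq0 -lt0n.
by rewrite ler_pM2l // /K1; lra.
Qed.

End Barrier.

(** * Levels of the cube, summation by parts, covariances as edge sums *)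

Section Levels.
Variables (R : realType) (n : nat).
Implicit Types (f : Omega n -> R) (x : Omega n) (w : nat -> R) (i : 'I_n).

Definition lvl x : nat := \sum_(i < n) x i.

Lemma lvl_flip i x : x i = false -> lvl (flip i x) = (lvl x).+1.
Proof.
move=> xi; rewrite /lvl !(bigD1 (P := xpredT) i) //= flip_id xi /= add0n.
by congr (_.+1); apply: eq_bigr => j /negPf ji; rewrite flipE ji addbF.
Qed.

Lemma lvl_le x : (lvl x <= n)%N.
Proof.
rewrite -[leqRHS]card_ord -sum1_card; apply: leq_sum => i _; exact: leq_b1.
Qed.

Lemma lvl_lt i x : x i = false -> (lvl x < n)%N.
Proof. by move=> xi; rewrite -(lvl_flip xi) lvl_le. Qed.

Lemma lvlR x : (lvl x)%:R = \sum_i (x i)%:R :> R.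
Proof. by rewrite natr_sum. Qed.

Definition edge_sum i w f : R :=
  expect (fun x => (~~ x i)%:R * w (lvl x) * (f (flip i x) - f x)).

Lemma edge_sum_flip i w f :
  edge_sum i w f =
  expect (fun x => f x * ((x i)%:R * w (lvl x).-1 - (~~ x i)%:R * w (lvl x))).
Proof.
rewrite /edge_sum (eq_expect (v := fun x => (~~ x i)%:R * w (lvl x) * f (flip i x) -
  (~~ x i)%:R * w (lvl x) * f x)) => [|x]; last by rewrite mulrBr.
rewrite expectB -(expect_flip i (fun x => (~~ x i)%:R * w (lvl x) * f (flip i x))).
rewrite -expectB; apply: eq_expect => x; rewrite flip_id negbK flipK.
case xi: (x i) => /=; last by ring.
have : flip i x i = false by rewrite flip_id xi.
by move=> /lvl_flip; rewrite flipK => -> /=; ring.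
Qed.

(** A vertex [x] is the upper end of [lvl x] edges, each weighted by the level below, and the lower
    end of [n - lvl x] edges. *)
Lemma sum_edge_sum w f :
  \sum_i edge_sum i w f =
  expect (fun x => f x * ((lvl x)%:R * w (lvl x).-1 - (n - lvl x)%:R * w (lvl x))).
Proof.
under eq_bigr => i _ do rewrite edge_sum_flip.
rewrite -expect_sum; apply: eq_expect => x.
rewrite -mulr_sumr sumrB -!mulr_suml -lvlR; congr (_ * (_ - _ * _)).
have en : n%:R = \sum_(i < n) 1 :> R by rewrite sumr_const card_ord.
rewrite natrB ?lvl_le // lvlR en -sumrB.
by apply: eq_bigr => i _; case: (x i); rewrite ?subrr ?subr0.
Qed.

(** The recursion of [edge_weight_rec] solved for its last unknown. At [k = n] the division is by
    zero and gives 0. *)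
Fixpoint edge_weight (r : R) k : R :=
  if k is k'.+1 then
    (k%:R * edge_weight r k' + r - (n < 2 * k)%:R) / (n - k)%:R
  else r / n%:R.

Let maj x : R := (Maj n x)%:R.

Lemma majE x : maj x = (n < 2 * lvl x)%:R.
Proof. by rewrite /maj ffunE. Qed.

Lemma edge_weight_rec k : (0 < n)%N -> (k < n)%N ->
  k%:R * edge_weight (expect maj) k.-1 - (n - k)%:R * edge_weight (expect maj) k =
    (n < 2 * k)%:R - expect maj.
Proof.
move=> n0; case: k => [|k] kn.
  by rewrite mul0r muln0 subn0 /= mulrC divfK ?pnatr_eq0 -?lt0n.
set r := expect maj; rewrite /= [(n - _)%:R * _]mulrC divfK; first by ring.
by rewrite pnatr_eq0 -lt0n subn_gt0.
Qed.

(* Summation by parts; at [k = n] the recursion holds because both sides have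
   mean zero. *)
Lemma edge_weight_rec_le k : (0 < n)%N -> (k <= n)%N ->
  k%:R * edge_weight (expect maj) k.-1 - (n - k)%:R * edge_weight (expect maj) k =
    (n < 2 * k)%:R - expect maj.
Proof.
move=> n0; rewrite leq_eqVlt => /predU1P[->|/edge_weight_rec->//].
set w := edge_weight _.
pose D k : R := k%:R * w k.-1 - (n - k)%:R * w k - ((n < 2 * k)%:R - expect maj).
apply/eqP; rewrite -subr_eq0 -/(D n); apply/eqP.
have D0 j : (j < n)%N -> D j = 0.
  by move=> jn; rewrite /D edge_weight_rec // subrr.
(* A constant function has zero edge sums, hence the mean zero. As [D] vanishes below level [n], and
   [top] is the only point of level [n], this forces [D n = 0]. *)
have : expect (fun x => D (lvl x)) = 0.
  have := sum_edge_sum w (fun=> 1).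
  rewrite big1 => [|i _]; last first.
    rewrite /edge_sum (eq_expect (v := fun=> 0)) ?expect_cst // => x.
    by rewrite subrr mulr0.
  move=> e; rewrite /D expectB [X in _ - X]expectB expect_cst.
  rewrite -[X in X - _](eq_expect (u := fun x =>
    1 * ((lvl x)%:R * w (lvl x).-1 - (n - lvl x)%:R * w (lvl x)))) => [|x]; last first.
    by rewrite mul1r.
  rewrite -e sub0r -(eq_expect (u := maj)) ?subrr ?oppr0 //.
  exact: majE.
pose top : Omega n := [ffun=> true].
have lt_top x : x != top -> (lvl x < n)%N.
  move=> xt; have [i xi] : exists i, ~~ x i.
    apply/existsP; rewrite -negb_forall; apply: contraNN xt => /forallP e.
    by apply/eqP/ffunP => i; rewrite ffunE e.
  by apply: (lvl_lt (i := i)); apply/negbTE.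
have lvl_top : lvl top = n.
  rewrite /lvl (eq_bigr (fun=> 1%N)) ?sum1_card ?card_ord // => i _.
  by rewrite ffunE.
rewrite expectE (bigD1 top) //= big1 => [|x /lt_top/D0//].
rewrite addr0 lvl_top => /eqP; rewrite mulf_eq0 invr_eq0 expf_eq0 pnatr_eq0 andbF /=.
by move/eqP.
Qed.

(** The covariance is the mean of [f * (maj - expect maj)], and the recursion makes the second
    factor the vertex weight of [sum_edge_sum]. *)
Lemma cov_maj_edge f : (0 < n)%N ->
  cov f maj = \sum_i edge_sum i (edge_weight (expect maj)) f.
Proof.
move=> n0; rewrite sum_edge_sum.
rewrite [RHS](eq_expect (v := fun x => f x * maj x - expect maj * f x)) => [|x].
  by rewrite expectB expectZ /cov [_ * expect f]mulrC.
by rewrite edge_weight_rec_le ?lvl_le // majE; ring.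
Qed.

Lemma expect_coord i : expect (fun x => (x i)%:R) = 2^-1 :> R.
Proof.
have := expect_flip i (fun x => (x i)%:R : R).
rewrite (eq_expect (v := fun x => 1 - (x i)%:R)) => [|x]; last first.
  by rewrite flip_id; case: (x i); rewrite ?subrr ?subr0.
by rewrite expectB expect_cst; lra.
Qed.

(** With unit weights a vertex receives [2 x_i - 1], twice the centred coordinate. *)
Lemma cov_coord_edge i f : cov f (fun x => (x i)%:R) = edge_sum i (fun=> 1) f / 2.
Proof.
rewrite edge_sum_flip /cov expect_coord.
rewrite [in RHS](eq_expect (v := fun x => 2 * (f x * (x i)%:R) - f x)).
  by rewrite expectB expectZ; lra.
by move=> x; case: (x i) => /=; ring.
Qed.

(** A point and its complement are never both in the majority. Complementing all coordinates but
    [i0], when [x i0] holds, gives levels summing to [n + 1], so one of the two points is in the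
    majority. The value [1/4] occurs at [n = 2]. *)
Lemma expect_maj_bounds : (0 < n)%N -> 4^-1 <= expect maj <= 3 / 4.
Proof.
move=> n0; pose i0 := Ordinal n0.
pose com x : Omega n := [ffun i => ~~ x i].
pose com' x : Omega n := [ffun i => x i (+) (i != i0)].
have comK : involutive com by move=> x; apply/ffunP => i; rewrite !ffunE negbK.
have com'K : involutive com' by move=> x; apply/ffunP => i; rewrite !ffunE addbK.
have lvl_com x : (lvl (com x) + lvl x = n)%N.
  rewrite /lvl -big_split /= (eq_bigr (fun=> 1%N)) ?sum1_card ?card_ord // => i _.
  by rewrite ffunE; case: (x i).
have lvl_com' x : x i0 -> (lvl (com' x) + lvl x = n.+1)%N.
  move=> xi; rewrite -(lvl_com x) -addSn; congr (_ + _)%N.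
  have -> : com' x = flip i0 (com x).
    by apply/ffunP => i; rewrite !ffunE; case: (x i); case: eqP.
  by rewrite lvl_flip // ffunE xi.
apply/andP; split; last first.
  have : expect maj + expect (fun x => maj (com x)) <= 1.
    rewrite -expectD -[leRHS](@expect_cst R n); apply: ler_expect => x.
    rewrite !majE -natrD lern1; have := lvl_com x.
    by case: ltnP => //; case: ltnP => //; lia.
  by rewrite (expect_inv _ comK); lra.
have : expect (fun x => (x i0)%:R : R) <= expect maj + expect (fun x => maj (com' x)).
  rewrite -expectD; apply: ler_expect => x.
  rewrite !majE -natrD ler_nat; have := lvl_com' x.
  case: (x i0) => // /(_ isT).
  by case: ltnP => //; case: ltnP => //; lia.
by rewrite (expect_inv _ com'K) expect_coord; lra.
Qed.

(** Distinct centred coordinates are orthogonal, their product being odd under a flip; each has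
    variance [1/4]. *)
Lemma variance_lvl :
  expect (fun x => ((lvl x)%:R - n%:R / 2) ^+ 2) = n%:R / 4 :> R.
Proof.
pose c i x : R := (x i)%:R - 2^-1.
have c_flip i x : c i (flip i x) = - c i x.
  by rewrite /c flip_id; case: (x i) => /=; lra.
rewrite (eq_expect (v := fun x => \sum_i \sum_j c i x * c j x)) => [|x].
  rewrite expect_sum.
  under eq_bigr => i _ do rewrite expect_sum.
  rewrite (eq_bigr (fun=> 4^-1)) ?sumr_const ?card_ord => [|i _].
    by rewrite -[_ *+ n]mulr_natl.
  rewrite (bigD1 i) //= [X in _ + X]big1 => [|j ji].
    rewrite (eq_expect (v := fun=> 4^-1)) ?expect_cst ?addr0 // => x.
    by rewrite /c; case: (x i) => /=; field.
  apply: (expect_flip_odd (i := i)) => x; rewrite c_flip mulNr; congr (- (_ * _)).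
  by rewrite /c flipE (negPf ji) addbF.
under eq_bigr => i _ do rewrite -mulr_sumr.
rewrite -mulr_suml -expr2 /c sumrB sumr_const card_ord -lvlR.
by rewrite -[2^-1 *+ n]mulr_natl.
Qed.

End Levels.

(** * Splitting the second moment into low and high degree *)

Section Energy.
Variables (R : realType) (n : nat).
Implicit Types (F : Omega n -> R) (x : Omega n) (S : {set 'I_n}).

(** The empty set gives the squared mean. Any other [S] is counted once for each of its elements:
    the first sum suffices when [#|S| <= d], and otherwise the second has total factor
    [#|S| / d >= 1]. *)
Lemma fourier_split_ddiff (d : nat) F : (0 < d)%N ->
  expect (fun x => F x ^+ 2) <= expect F ^+ 2 +
    \sum_i (\sum_(S : {set 'I_n} | (#|S| <= d)%N) four (ddiff i F) S ^+ 2 +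
            d%:R^-1 * expect (fun x => ddiff i F x ^+ 2)).
Proof.
move=> d0; have dR : 0 < d%:R :> R by rewrite ltr0n.
under eq_bigr => i _ do rewrite -parseval mulr_sumr big_mkcond -big_split /=.
rewrite exchange_big /= -parseval.
rewrite (_ : expect F ^+ 2 = \sum_(S : {set 'I_n} | S == set0) four F S ^+ 2); last first.
  rewrite big_pred1_eq; congr (_ ^+ 2); apply: eq_expect => x.
  by rewrite /ch big_set0 mulr1.
rewrite [X in _ <= X + _]big_mkcond -big_split; apply: ler_sum => S _ /=.
have t0 : 0 <= four F S ^+ 2 by rewrite sqr_ge0.
rewrite (eq_bigr (fun i => (i \in S)%:R *
    ((#|S| <= d)%N%:R * four F S ^+ 2 + d%:R^-1 * four F S ^+ 2))); last first.
  move=> i _; rewrite four_ddiff; case: (i \in S); case: (#|S| <= d)%N => /=;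
    by rewrite ?expr0n /=; ring.
rewrite -mulr_suml -natr_sum (_ : (\sum_i (i \in S) = #|S|)%N); last first.
  by rewrite -sum1_card [RHS]big_mkcond.
set t := four F S ^+ 2 in t0 *.
have td : 0 <= d%:R^-1 * t by rewrite mulr_ge0 ?invr_ge0 ?ler0n.
have S0 : 0 <= #|S|%:R :> R by rewrite ler0n.
case: eqVneq => [->|Sn0]; first by rewrite cards0 mul0r addr0.
rewrite add0r; case: leqP => Sd; rewrite ?mul1r ?mul0r ?add0r.
  have : 1 <= #|S|%:R :> R by rewrite ler1n card_gt0.
  nra.
rewrite mulrA -{1}[t]mul1r ler_wpM2r // ler_pdivlMr // mul1r ler_nat.
exact: ltnW.
Qed.

Lemma sqr_sum_le2 (a b : R) : (a + b) ^+ 2 <= 2 * a ^+ 2 + 2 * b ^+ 2.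
Proof. by have := sqr_ge0 (a - b); nra. Qed.

(** The error [e] is charged its full norm in both degree ranges, by Parseval and by [d^-1 <= 1],
    whence the factor [4 = 2 + 2]. *)
Lemma fourier_split (d : nat) F (g e : 'I_n -> Omega n -> R) : (0 < d)%N ->
  (forall i x, ddiff i F x = g i x + e i x) ->
  expect (fun x => F x ^+ 2) <= expect F ^+ 2 +
    \sum_i (2 * (\sum_(S : {set 'I_n} | (#|S| <= d)%N) four (g i) S ^+ 2) +
            2 / d%:R * expect (fun x => g i x ^+ 2) +
            4 * expect (fun x => e i x ^+ 2)).
Proof.
move=> d0 Dge; apply: le_trans (fourier_split_ddiff F d0) _.
rewrite lerD2l; apply: ler_sum => i _.
have dR : 1 <= d%:R :> R by rewrite ler1n.
have d1 : d%:R^-1 <= 1 :> R by rewrite invf_le1 // (lt_le_trans _ dR).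
have dp : 0 <= d%:R^-1 :> R by rewrite invr_ge0 ler0n.
have e0 : 0 <= expect (fun x => e i x ^+ 2) by apply: expect_ge0 => x; rewrite sqr_ge0.
have hi : expect (fun x => ddiff i F x ^+ 2) <=
    2 * expect (fun x => g i x ^+ 2) + 2 * expect (fun x => e i x ^+ 2).
  rewrite -!expectZ -expectD; apply: ler_expect => x; rewrite Dge.
  exact: sqr_sum_le2.
have lo : \sum_(S : {set 'I_n} | (#|S| <= d)%N) four (ddiff i F) S ^+ 2 <=
    2 * (\sum_(S : {set 'I_n} | (#|S| <= d)%N) four (g i) S ^+ 2) +
    2 * expect (fun x => e i x ^+ 2).
  apply: (@le_trans _ _ (\sum_(S : {set 'I_n} | (#|S| <= d)%N)
     (2 * four (g i) S ^+ 2 + 2 * four (e i) S ^+ 2))).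
    apply: ler_sum => S _; apply: le_trans (sqr_sum_le2 _ _).
    by rewrite -fourD /four (eq_expect (v := fun x => (g i x + e i x) * ch R S x)) // => x;
      rewrite Dge.
  rewrite big_split -!mulr_sumr lerD2l ler_pM2l // -parseval.
  rewrite [leLHS]big_mkcond; apply: ler_sum => S _.
  by case: ifP => // _; rewrite sqr_ge0.
have : d%:R^-1 * expect (fun x => ddiff i F x ^+ 2) <=
    d%:R^-1 * (2 * expect (fun x => g i x ^+ 2) + 2 * expect (fun x => e i x ^+ 2)).
  by rewrite ler_wpM2l.
nra.
Qed.

End Energy.

(** * The cutoff and the energy inside the bulk *)

Section Bulk.
Variables (R : realType) (n : nat) (A : {set Omega n}) (s : R).
Hypotheses (s0 : 0 < s) (sn : s ^+ 2 = n%:R).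
Implicit Types (x : Omega n) (i : 'I_n).

Definition cutoff x : R :=
  Num.max 0 (1 - `|(lvl x)%:R - n%:R / 2| / (4 * s)).

(** The cutoff is tested at [x] alone, where it multiplies the derivative in [bulk_energy]; the two
    ends of an edge may therefore disagree. *)
Definition bulk_pivotal i : pred (Omega n) :=
  fun x => ((x \in A) != (flip i x \in A)) && (cutoff x != 0).

Definition bulk_inf i : R := expect (fun x => (bulk_pivotal i x)%:R).

Lemma bulk_inf_ge0 i : 0 <= bulk_inf i.
Proof. by apply: expect_ge0 => x; rewrite ler0n. Qed.

Lemma cutoff_ge0 x : 0 <= cutoff x.
Proof. by rewrite le_max lexx. Qed.

Lemma cutoff_le1 x : cutoff x <= 1.
Proof. by rewrite ge_max ler01 lerBlDr lerDl divr_ge0 // mulr_ge0 // ltW. Qed.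

Lemma cutoff_lip i x : `|cutoff x - cutoff (flip i x)| <= (4 * s)^-1.
Proof.
have s4 : 0 < (4 * s)^-1 by rewrite invr_gt0 mulr_gt0.
suff H y : cutoff y <= cutoff (flip i y) + (4 * s)^-1.
  by rewrite ler_norml; have := H x; have := H (flip i x); rewrite flipK; lra.
rewrite ge_max; apply/andP; split; first by rewrite addr_ge0 ?cutoff_ge0 // ltW.
apply: (@le_trans _ _ (1 - `|(lvl (flip i y))%:R - n%:R / 2| / (4 * s) + (4 * s)^-1)).
  suff : `|(lvl (flip i y))%:R - n%:R / 2| / (4 * s) <=
         (`|(lvl y)%:R - n%:R / 2| + 1) / (4 * s) by rewrite mulrDl mul1r; lra.
  rewrite ler_pM2r //.
  have : `|(lvl (flip i y))%:R - (lvl y)%:R| <= 1 :> R.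
    case yi: (y i).
      have : flip i y i = false by rewrite flip_id yi.
      move=> /lvl_flip; rewrite flipK => ->; rewrite -natr1 opprD addrA subrr add0r.
      by rewrite normrN normr1.
    by rewrite (lvl_flip yi) -natr1 addrAC subrr add0r normr1.
  have := ler_normD ((lvl (flip i y))%:R - (lvl y)%:R : R) ((lvl y)%:R - n%:R / 2).
  by rewrite addrA subrK; lra.
by rewrite lerD2r le_max lexx orbT.
Qed.

Lemma cutoff_neq0 x : cutoff x != 0 ->
  n%:R / 2 - 4 * s <= (lvl x)%:R <= n%:R / 2 + 4 * s.
Proof.
have [h _|h] := leP 0 (1 - `|(lvl x)%:R - n%:R / 2| / (4 * s)); last first.
  by rewrite /cutoff max_l ?eqxx // ltW.
move: h; rewrite subr_ge0 ler_pdivrMr ?mulr_gt0 // mul1r ler_norml.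
by move=> /andP[h1 h2]; apply/andP; lra.
Qed.

(** With [t] the centred level, [1 - cutoff <= |t| / (4 s) <= t^2 / (4 s^2) + 1/16], and the
    variance [s^2 / 4] of the level gives [1/16 + 1/16]. *)
Lemma expect_cutoff : expect (fun x => 1 - cutoff x) <= 8^-1.
Proof.
have s4 : 0 < 4 * s by rewrite mulr_gt0.
apply: (@le_trans _ _ (expect (fun x => (4 * s ^+ 2)^-1 * ((lvl x)%:R - n%:R / 2) ^+ 2 + 16^-1))).
  apply: ler_expect => x; set t := _ - n%:R / 2.
  have : 1 - `|t| / (4 * s) <= cutoff x by rewrite le_max lexx orbT.
  suff : `|t| / (4 * s) <= (4 * s ^+ 2)^-1 * t ^+ 2 + 16^-1 by lra.
  rewrite -[t ^+ 2]real_normK ?num_real //; set a := `|t|.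
  rewrite (_ : a / (4 * s) = (a / s) / 4); last by field; rewrite gt_eqF.
  rewrite (_ : (4 * s ^+ 2)^-1 * a ^+ 2 = (a / s) ^+ 2 / 4); last by field; rewrite gt_eqF.
  have := sqr_ge0 (a / s - 2^-1); nra.
rewrite expectD expectZ expect_cst variance_lvl -sn.
have -> : (4 * s ^+ 2)^-1 * (s ^+ 2 / 4) = 16^-1 by field; rewrite gt_eqF.
lra.
Qed.

Let sg x : R := 2 * ind1 R A x - 1.

(* A low-degree/high-degree splitting of [sg * cutoff], with [sg = 2 1_A - 1]; the
   derivative of the cutoff costs only a small constant, not the [log n] that the
   pivotal part must provide. *)
Lemma bulk_energy (d : nat) : (0 < d)%N -> expect (ind1 R A) = 2^-1 ->
  exists W : 'I_n -> R,
    (forall i, 0 <= W i /\ W i ^+ 2 <= 9 ^+ d * bulk_inf i ^+ 3) /\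
    2^-1 <= 2 * (\sum_i W i) + 2 / d%:R * (\sum_i bulk_inf i).
Proof.
move=> d0 bal.
have sg2 x : sg x ^+ 2 = 1.
  by rewrite /sg /ind1; case: (x \in A) => /=; ring.
have sgN x : `|sg x| <= 1.
  by rewrite -(ler_pXn2r (n := 2)) ?nnegrE // real_normK ?num_real // sg2 expr1n.
pose F x := sg x * cutoff x.
(* Discrete Leibniz rule: [g] is the pivotal part of the derivative of [F], [e] the part due to the
   cutoff. *)
pose g i x := cutoff x * ((sg x - sg (flip i x)) / 2).
pose e i x := sg (flip i x) * (cutoff x - cutoff (flip i x)) / 2.
have Dge i x : ddiff i F x = g i x + e i x.
  by rewrite /ddiff /F /g /e; field.
have gb i x : `|g i x| <= (bulk_pivotal i x)%:R.
  rewrite /g /bulk_pivotal; have [->|c0] := eqVneq (cutoff x) 0.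
    by rewrite mul0r normr0 ler0n.
  rewrite andbT normrM (ger0_norm (cutoff_ge0 x)) /sg /ind1.
  apply: (@le_trans _ _ (1 * `|(2 * (x \in A)%:R - 1 -
     (2 * (flip i x \in A)%:R - 1)) / 2 : R|)).
    by rewrite ler_wpM2r // cutoff_le1.
  rewrite mul1r; case: (x \in A); case: (flip i x \in A) => /=.
  - by rewrite subrr mul0r normr0.
  - by rewrite (_ : _ / 2 = 1) ?normr1 //; field.
  - by rewrite (_ : _ / 2 = -1) ?normrN ?normr1 //; field.
  - by rewrite subrr mul0r normr0.
exists (fun i => \sum_(S : {set 'I_n} | (#|S| <= d)%N) four (g i) S ^+ 2).
split=> [i|].
  split; first by apply: sumr_ge0 => S _; rewrite sqr_ge0.
  exact: low_degree_weight (gb i).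
have g2 i : expect (fun x => g i x ^+ 2) <= bulk_inf i.
  apply: ler_expect => x; rewrite -real_normK ?num_real //.
  have := gb i x; case: (bulk_pivotal i x) => h; first by rewrite expr_le1.
  by move: h; rewrite normr_le0 => /eqP ->; rewrite normr0 expr0n.
(* By the Lipschitz bound; summed over the [n] directions this costs only [1/16]. *)
have e2 i : 4 * expect (fun x => e i x ^+ 2) <= (16 * n%:R)^-1.
  rewrite -sn -expectZ -[leRHS](@expect_cst R n); apply: ler_expect => x.
  rewrite /e expr_div_n exprMn sg2 mul1r -[_ ^+ 2]real_normK ?num_real //.
  have := cutoff_lip i x; set c := `|_|; move=> cl.
  have : c ^+ 2 <= (4 * s)^-1 ^+ 2 by rewrite ler_pXn2r ?nnegrE ?normr_ge0 ?invr_ge0 ?mulr_ge0 // ltW.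
  rewrite (_ : (16 * s ^+ 2)^-1 = (4 * s)^-1 ^+ 2); first by lra.
  by field; rewrite gt_eqF.
have EF2 : 3 / 4 <= expect (fun x => F x ^+ 2).
  apply: (@le_trans _ _ (expect (fun x => 1 - 2 * (1 - cutoff x)))).
    by rewrite expectB expectZ expect_cst; have := expect_cutoff; lra.
  apply: ler_expect => x; rewrite /F exprMn sg2 mul1r.
  by have := sqr_ge0 (1 - cutoff x); nra.
have Esg : expect sg = 0 by rewrite /sg expectB expectZ expect_cst bal; lra.
(* Since [sg] has mean zero, only [1 - cutoff] contributes, at most [1/8] in mean. *)
have EF : expect F ^+ 2 <= 64^-1.
  have EFE : expect F = - expect (fun x => sg x * (1 - cutoff x)).
    rewrite -[LHS]subr0 -Esg -opprB -expectB; congr (- _).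
    by apply: eq_expect => x; rewrite /F; ring.
  rewrite (_ : 64^-1 = 8^-1 ^+ 2); last by field.
  rewrite -real_normK ?num_real // ler_pXn2r ?nnegrE ?normr_ge0 ?invr_ge0 //.
  apply: le_trans expect_cutoff; rewrite EFE normrN ler_norml -expectN.
  apply/andP; split; apply: ler_expect => x; have := cutoff_le1 x;
    have := sgN x; rewrite ler_norml => /andP[]; nra.
(* The balance is [3/4 - 1/64 - 1/16 >= 1/2]. *)
have := fourier_split d0 Dge; rewrite !big_split /= -!mulr_sumr.
have : \sum_i 4 * expect (fun x => e i x ^+ 2) <= 16^-1.
  apply: (@le_trans _ _ (\sum_(i < n) (16 * n%:R)^-1)); first exact: ler_sum.
  rewrite sumr_const card_ord -[_ *+ n]mulr_natl -sn.
  by rewrite (_ : _ * _ = 16^-1) //; field; rewrite gt_eqF.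
have : 2 / d%:R * (\sum_i expect (fun x => g i x ^+ 2)) <= 2 / d%:R * (\sum_i bulk_inf i).
  by rewrite ler_wpM2l ?divr_ge0 ?ler0n //; apply: ler_sum.
rewrite -!mulr_sumr; lra.
Qed.

End Bulk.

(** * Pivotal edges of an increasing family *)

Section Increasing.
Variables (R : realType) (n : nat) (A : {set Omega n}).
Hypothesis incA : increasing A.
Implicit Types (x : Omega n) (i : 'I_n).

Lemma increasing_flip i x : x i = false -> (x \in A) ==> (flip i x \in A).
Proof.
move=> xi; apply/implyP => xA; apply: incA xA _ => j.
by rewrite flipE; case: eqP => [->|_]; rewrite ?xi ?addbF ?implybb.
Qed.

(** Monotonicity makes every edge increment 0 or 1, so nothing cancels. Folding both ends of an edge
    onto the lower one costs the factor 2; if only the upper end meets the cutoff, the lower one may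
    sit one level further down, hence the [- 1] in the range of [k]. *)
Lemma bulk_inf_edge_sum (s c : R) (w : nat -> R) i :
  0 < s -> 0 <= c ->
  (forall k, (k < n)%N -> 0 <= w k /\
     (n%:R / 2 - 4 * s - 1 <= k%:R <= n%:R / 2 + 4 * s -> c <= w k)) ->
  c * bulk_inf A s i <= 2 * edge_sum i w (ind1 R A).
Proof.
move=> s0 c0 wc.
pose b x : R := (bulk_pivotal A s i x)%:R.
have -> : bulk_inf A s i =
    expect (fun x => (~~ x i)%:R * b x + (~~ x i)%:R * b (flip i x)).
  rewrite expectD -(expect_flip i (fun x => (~~ x i)%:R * b (flip i x))) -expectD.
  apply: eq_expect => x; rewrite flipK flip_id negbK.
  by case: (x i) => /=; rewrite ?mul0r ?mul1r ?add0r ?addr0.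
rewrite -!expectZ; apply: ler_expect => x.
case xi: (x i) => /=; first by rewrite !mul0r addr0 !mulr0.
rewrite !mul1r; have [w0 wb] := wc _ (lvl_lt xi).
have := increasing_flip xi; rewrite /b /bulk_pivotal flipK /ind1.
have h1 : cutoff s x != 0 -> c <= w (lvl x).
  by move=> /(cutoff_neq0 s0)/andP[l1 l2]; apply: wb; apply/andP; lra.
have h2 : cutoff s (flip i x) != 0 -> c <= w (lvl x).
  move=> /(cutoff_neq0 s0); rewrite (lvl_flip xi) -[(lvl x).+1%:R]natr1 => /andP[l1 l2].
  by apply: wb; apply/andP; lra.
case: (x \in A); case: (flip i x \in A) => //= _.
- by rewrite subrr addr0 !mulr0.
- case: (cutoff s x =P 0) h1 => [_ _|_ /(_ isT)];
  case: (cutoff s (flip i x) =P 0) h2 => [_ _|_ /(_ isT)] /=; lra.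
- by rewrite subrr addr0 !mulr0.
Qed.

End Increasing.

(** * Choice of the degree and conclusion *)

Lemma expect_ind1 (R : realType) (n : nat) (A : {set Omega n}) :
  expect (ind1 R A) = mu R A.
Proof.
rewrite expectE /mu card_ffun card_bool card_ord natrX mulrC; congr (_ / _).
rewrite -sum1_card natr_sum [RHS]big_mkcond; apply: eq_bigr => x _.
by rewrite /ind1; case: (x \in A).
Qed.

(** Take [d - 1] to be the integer part of the logarithm of [n] in base [81^2]. The first bound uses
    [81 <= 2^7] and [ln 2 <= 1]. The base is [81 = 9 * 9]: one [9^d] comes from hypercontractivity,
    the other absorbs [d^3]. *)
Lemma log_scale (R : realType) (n : nat) (s : R) :
  (0 < n)%N -> 0 <= s -> s ^+ 2 = n%:R ->
  exists d, [/\ (0 < d)%N, ln n%:R <= 14 * d%:R :> R & 81 ^+ d <= 81 * s].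
Proof.
move=> n0 s0 sn.
have ln2 : ln 2 <= 1 :> R.
  by rewrite (_ : 2 = 1 + 1 :> R); [apply: le_ln1Dx; lra | ring].
have b1 : (1 < 81 ^ 2)%N by rewrite -{1}(exp1n 2) ltn_exp2r.
have /andP[lo hi] := trunc_log_bounds b1 n0.
set t := trunc_log (81 ^ 2) n in lo hi; exists t.+1; split=> //.
  have n2 : n%:R <= 2 ^+ (14 * t.+1) :> R.
    rewrite -natrX ler_nat (leq_trans (ltnW hi)) //.
    by rewrite -expnM -[14%N]/(7 * 2)%N -mulnA (expnM _ 7) leq_exp2r.
  have : ln n%:R <= ln (2 ^+ (14 * t.+1)) :> R.
    by rewrite ler_ln // posrE ?ltr0n // exprn_gt0.
  rewrite lnXn // => /le_trans; apply; rewrite -[_ *+ _]mulr_natl natrM.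
  by rewrite ler_piMr ?mulr_ge0 ?ler0n.
rewrite exprS ler_pM2l // -(ler_pXn2r (n := 2)) ?nnegrE ?exprn_ge0 // sn.
by rewrite exprAC -!natrX ler_nat.
Qed.

Theorem theorem2 (R : realType) :
  exists c : R, 0 < c /\
    forall (n : nat) (A : {set Omega n}),
      (1 <= n)%N -> increasing A -> balanced R A ->
      exists h : boolfun n,
        h \in Maj n |: [set xproj i | i : 'I_n] /\
        cov (ind1 R A) (fun x => (h x)%:R) >= c * (ln n%:R / Num.sqrt n%:R).
Proof.
(* Any positive constant satisfying [c1] and [c2] below would do. *)
exists ((100 ^+ 2)^-1); split; first by rewrite invr_gt0 exprn_gt0.
move=> n A n0 incA; rewrite /balanced div1r => bal.
set s := Num.sqrt n%:R; set c : R := _^-1.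
have c0 : 0 < c by rewrite invr_gt0 exprn_gt0.
have c1 : 56 * 81 * c <= 1.
  by rewrite ler_pdivrMr ?exprn_gt0 //; lra.
have c2 : 4 * (66 * 14 * c) < 1 / 2.
  by rewrite !mulrA ltr_pdivrMr ?exprn_gt0 //; lra.
clearbody c.
have nR : 0 < n%:R :> R by rewrite ltr0n.
have s0 : 0 < s by rewrite sqrtr_gt0.
have sn : s ^+ 2 = n%:R by rewrite sqr_sqrtr // ltW.
have [d [d0 ln_d d81]] := log_scale n0 (ltW s0) sn.
have dR : 0 < d%:R :> R by rewrite ltr0n.
set q := c * _.
have qd : q <= 14 * d%:R * c / s.
  by rewrite /q mulrA ler_pM2r ?invr_gt0 // mulrC ler_pM2r.
pose good (h : boolfun n) := q <= cov (ind1 R A) (fun x => (h x)%:R).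
have [maj_good|maj_bad] := boolP (good (Maj n)).
  by exists (Maj n); rewrite setU11.
have [/existsP[i x_good]|] := boolP [exists i, good (xproj i)].
  by exists (xproj i); split=> //; rewrite in_setU1 imset_f ?orbT.
rewrite negb_exists => /forallP x_bad; exfalso.
pose del i := bulk_inf A s i.
have del0 i : 0 <= del i := bulk_inf_ge0 A s i.
(* Here [del i] is at most four times the covariance with coordinate [i], and [56 = 4 * 14]. *)
have del_small i : del i <= 56 * d%:R * c / s.
  have := x_bad i; rewrite -ltNge.
  have -> : cov (ind1 R A) (fun x => (xproj i x)%:R) =
            cov (ind1 R A) (fun x => (x i)%:R).
    by rewrite /cov; congr (_ - _ * _); apply: eq_expect => x; rewrite ffunE.
  rewrite cov_coord_edge.
  have := @bulk_inf_edge_sum R n A incA s 1 (fun=> 1) i s0 ler01.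
  rewrite mul1r -/(del i) => /(_ (fun k _ => conj ler01 (fun=> lexx 1))).
  lra.
(* The edge weights are at least [1 / (33 s)] in the bulk, so the sum is at most [66 s] times the
   covariance with [Maj]. *)
have sum_del : \sum_i del i <= 66 * 14 * d%:R * c.
  have wb := edge_weight_bounds n0 sn (expect_maj_bounds R n0)
    (fun k => edge_weight_rec_le R n0).
  have sc0 : 0 <= s / (33 * n%:R) by rewrite divr_ge0 ?mulr_ge0 ?ltW.
  have : s / (33 * n%:R) * (\sum_i del i) <=
         2 * cov (ind1 R A) (fun x => (Maj n x)%:R).
    rewrite cov_maj_edge // !mulr_sumr; apply: ler_sum => i _.
    exact: bulk_inf_edge_sum.
  move: maj_bad; rewrite -ltNge => maj_bad.
  have -> : s / (33 * n%:R) = (33 * s)^-1.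
    by rewrite -sn; field; rewrite gt_eqF.
  rewrite mulrC ler_pdivrMr ?mulr_gt0 // => /le_trans; apply.
  apply: (@le_trans _ _ (2 * (14 * d%:R * c / s) * (33 * s))).
    by rewrite ler_pM2r ?mulr_gt0 // ler_pM2l // ltW // (lt_le_trans maj_bad).
  by rewrite le_eqVlt; apply/orP; left; apply/eqP; field; rewrite gt_eqF.
have [W [WB]] := bulk_energy s0 sn d0 (etrans (expect_ind1 R A) bal).
(* It suffices that [9^d d^2 del <= 1]. By [del_small] the left side is at most [56 c 9^d d^3 / s],
   and [9^d d^3 <= 81^d <= 81 s], so [c1] concludes. *)
have Wd i : W i <= del i / d%:R.
  have [W0 W2] := WB i.
  rewrite -(ler_pXn2r (n := 2)) ?nnegrE ?divr_ge0 ?ler0n //.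
  apply: le_trans W2 _; rewrite -/(del i) expr_div_n ler_pdivlMr ?exprn_gt0 //.
  rewrite [leLHS](_ : _ = (9 ^+ d * d%:R ^+ 2 * del i) * del i ^+ 2); last by ring.
  rewrite -[leRHS]mul1r ler_wpM2r ?sqr_ge0 //.
  apply: (@le_trans _ _ (9 ^+ d * d%:R ^+ 2 * (56 * d%:R * c / s))).
    by rewrite ler_wpM2l // mulr_ge0 ?exprn_ge0.
  rewrite mulrA ler_pdivrMr // mul1r.
  have d3 : d%:R ^+ 3 <= 9 ^+ d :> R.
    rewrite -!natrX ler_nat (@leq_trans (8 ^ d)%N) ?leq_exp2r //.
    by rewrite -[8%N]/(2 ^ 3)%N expnAC leq_exp2r // ltnW // ltn_expl.
  have : 9 ^+ d * d%:R ^+ 3 <= 81 ^+ d :> R.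
    rewrite (_ : 81 = 9 * 9); last by ring.
    by rewrite exprMn ler_wpM2l ?exprn_ge0.
  rewrite (_ : 9 ^+ d * d%:R ^+ 2 * _ = 56 * c * (9 ^+ d * d%:R ^+ 3)); last by ring.
  nra.
have sumW : \sum_i W i <= (\sum_i del i) / d%:R.
  by rewrite mulr_suml; apply: ler_sum => i _; apply: Wd.
(* The energy inequality now reads [1/2 <= 4 * (66 * 14 * c)], contradicting [c2]. *)
have : (\sum_i del i) / d%:R <= 66 * 14 * c.
  by rewrite ler_pdivrMr // mulrAC.
rewrite -[\sum_i bulk_inf _ _ _]/(\sum_i del i).
rewrite (_ : 2 / d%:R * _ = 2 * ((\sum_i del i) / d%:R)); last by ring.
lra.
Qed.
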